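(* Let $\kappa$ be a perfect field, let $r, m, n \geq 2$ be integers, and let $X_\ell = (x^\ell_{ij})$, $1 \leq \ell \leq r$, be $r$ matrices of size $m \times n$ whose entries are $rmn$ distinct indeterminates. Let $R = \kappa[x^\ell_{ij} \mid 1 \leq i \leq m,\ 1 \leq j \leq n,\ 1 \leq \ell \leq r]$ with the standard grading, let $H$ be the $m \times rn$ horizontal concatenation and $V$ the $rm \times n$ vertical concatenation of $X_1,\dots,X_r$, let $I = I_2(H) + I_2(V) \subseteq R$, and let $\mathcal{X}$ be the projective variety cut out by $I$ (the toric double determinantal variety on $r$ matrices of size $m \times n$). Then the dimension of the projective variety $\mathcal{X}$ is $m+n+r-3$.
   Context: For a matrix $M$ with entries in a commutative ring and a positive integer $a$, $I_a(M)$ denotes the ideal generated by the $a$-minors (determinants of $a \times a$ submatrices) of $M$. The horizontal concatenation is $H = \begin{bmatrix} X_1 & \cdots & X_r \end{bmatrix}$ and the vertical concatenation is $V = \begin{bmatrix} X_1 \\ \vdots \\ X_r \end{bmatrix}$. The homogeneous coordinate ring of $\mathcal{X}$ is $S = R/I$. *)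

(* Defs.v *)
From HB Require Import structures.
From mathcomp Require Import all_boot all_order all_algebra all_field.
From mathcomp Require Import boolp classical_sets.
From mathcomp Require Import mpoly.

Set Implicit Arguments.
Unset Strict Implicit.
Unset Printing Implicit Defensive.

Import GRing.Theory.

Local Open Scope ring_scope.
Local Open Scope classical_set_scope.

Definition perfect_field (k : fieldType) : Prop :=
  forall p : {poly k}, irreducible_poly p -> separable_poly p.

Definition ideal_generated (A : comNzRingType) (G : set A) : set A :=
  [set p | exists s : seq (A * A),
     (forall x, x \in s -> G x.2) /\ p = \sum_(x <- s) x.1 * x.2].

Definition ideal_sum (A : comNzRingType) (I J : set A) : set A :=
  [set x + y | x in I & y in J].

Definition minors (A : comNzRingType) (a p q : nat) (M : 'M[A]_(p, q)) : set A :=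
  [set d | exists (f : 'I_a -> 'I_p) (g : 'I_a -> 'I_q),
     [/\ {homo f : i j / (i < j)%N}, {homo g : i j / (i < j)%N}
       & d = \det (mxsub f g M)]].

Definition minor_ideal (A : comNzRingType) (a p q : nat) (M : 'M[A]_(p, q)) :
  set A := ideal_generated (minors a M).

(* A topology on a set of points of T is given by its family C of closed sets;
   irreducible sets are nonempty, and the dimension is the supremum of the
   lengths of strict chains Z_0 < ... < Z_d of irreducible closed sets. *)
Definition irreducible_closed (T : Type) (C : set (set T)) (Z : set T) : Prop :=
  [/\ C Z, Z !=set0
    & forall A B, C A -> C B -> Z = A `|` B -> Z = A \/ Z = B].

Definition irreducible_chain (T : Type) (C : set (set T)) (d : nat) : Prop :=
  exists Z : nat -> set T,
    (forall i, (i <= d)%N -> irreducible_closed C (Z i)) /\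
    (forall i, (i < d)%N -> Z i `<` Z i.+1).

Definition has_dim (T : Type) (C : set (set T)) (d : nat) : Prop :=
  irreducible_chain C d /\ forall e, irreducible_chain C e -> (e <= d)%N.

Section Proj.
Variables (k : fieldType) (N : nat).
Local Notation R := {mpoly k[N]}.

Definition homogeneous_ideal (P : set R) : Prop :=
  forall d p, P p -> P (pihomog mdeg d p).

Definition irrelevant_ideal : set R := [set p | p@_0%MM = 0].

(* [idealr_closed] includes properness. *)
Definition Proj : set (set R) :=
  [set P : set R |
    [/\ idealr_closed (mem P), prime_idealr_closed (mem P),
        homogeneous_ideal P & ~ (irrelevant_ideal `<=` P)]].

Definition proj_zeros (G : set R) : set (set R) :=
  Proj `&` [set P : set R | G `<=` P].

(* Closed subsets of X for the topology induced by the Zariski topology of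
   Proj R, whose closed sets are the zero loci of homogeneous polynomials. *)
Definition zariski_closed (X : set (set R)) : set (set (set R)) :=
  [set X `&` proj_zeros G | G in
     [set G | forall p, G p -> exists d, p \is d.-homog]].

Definition projective_dim (X : set (set R)) (d : nat) : Prop :=
  has_dim (zariski_closed X) d.
End Proj.

Section ToricDoubleDeterminantal.
Variables (k : fieldType) (r m n : nat).

Definition nvars : nat := #|{: 'I_r * 'I_m * 'I_n}|.

Definition X_mx (l : 'I_r) : 'M[{mpoly k[nvars]}]_(m, n) :=
  \matrix_(i, j) 'X_(enum_rank (l, i, j)).

Definition H_mx := \mxrow_(l < r) X_mx l.

Definition V_mx := \mxcol_(l < r) X_mx l.

Definition toric_ddv_ideal : set {mpoly k[nvars]} :=
  ideal_sum (minor_ideal 2 H_mx) (minor_ideal 2 V_mx).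

Definition toric_ddv : set (set {mpoly k[nvars]}) :=
  proj_zeros toric_ddv_ideal.
End ToricDoubleDeterminantal.

Arguments toric_ddv_ideal : clear implicits.
Arguments toric_ddv : clear implicits.

(* Main.v *)
From HB Require Import structures.
Require Import Defs.
From mathcomp Require Import all_boot all_order all_algebra.
From mathcomp Require Import boolp classical_sets mpoly.
From mathcomp Require Import zify ring.

Set Implicit Arguments.
Unset Strict Implicit.
Unset Printing Implicit Defensive.

Import GRing.Theory.
Local Open Scope ring_scope.
Local Open Scope classical_set_scope.

(** The points of the variety are the relevant homogeneous primes above the
    ideal [I] of 2-minors, and taking vanishing ideals turns a chain of
    irreducible closed sets into a decreasing chain of such primes.  The claim
    is thus that the longest of these chains have [r + m + n - 3] steps, the
    dimension of P^(r-1) x P^(m-1) x P^(n-1), whose Segre embedding the variety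
    is.

    Upper bound.  Some variable [x0 = x_(l0,i0,j0)] lies outside the largest
    prime [P_0] of the chain.  A 2-minor of [V] and one of [H] give, modulo [I],
      [x0^2 x_(l,i,j) = x_(l,i0,j0) x_(l0,i,j0) x_(l0,i0,j)],
    so up to a power of [x0] every polynomial is congruent to one in the
    [s = r + m + n - 2] variables of the star of [x0], those sharing at least
    two indices with it ([star_map_localized]).  As no prime of the chain
    contains [x0], contracting the chain to the polynomial ring in the star
    variables keeps it strict, and the contracted irrelevant ideal prolongs it
    by one step at the top.  It remains to see that such a chain in a polynomial
    ring in [s] variables has at most [s] steps ([polynomial_chain_le]).  This
    follows by counting: choose [f_i] in the [i]-th ideal and outside the next
    one; the [D^L] products of the [f_i] with exponents below [D] are linearly
    independent modulo the last ideal, but their degrees are linear in [D], so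
    they lie in a space of dimension [O(D^s)], and [L <= s].

    Lower bound.  The kernel of [x_(l,i,j) |-> a_l b_i c_j] is a homogeneous
    prime above [I], and it stays so when some of the variables [a_l], [b_i],
    [c_j] are set to zero.  Setting all but [a_0], [b_0], [c_0] to zero and
    restoring the others one at a time gives [r + m + n - 3] strict inclusions
    of irreducible closed sets: products of ever larger linear subspaces of the
    three factors ([toric_chain]). *)

(** * Ideals and primes given as sets *)

Lemma ideal_intro (A : comNzRingType) (P : set A) :
  P 0 -> ~ P 1 -> (forall a u v, P u -> P v -> P (a * u + v)) ->
  idealr_closed (mem P).
Proof.
move=> P0 P1 PD; split; first exact: mem_set.
  by apply/negP => /set_mem.
by move=> a u v /set_mem Pu /set_mem Pv; apply/mem_set/PD.
Qed.

Lemma ideal0 (A : comNzRingType) (P : set A) : idealr_closed (mem P) -> P 0.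
Proof. by case=> /set_mem. Qed.

Lemma ideal1 (A : comNzRingType) (P : set A) : idealr_closed (mem P) -> ~ P 1.
Proof. by case=> _ /negP P1 _ /mem_set. Qed.

Lemma idealDM (A : comNzRingType) (P : set A) (a u v : A) :
  idealr_closed (mem P) -> P u -> P v -> P (a * u + v).
Proof. by case=> _ _ PD /mem_set Pu /mem_set Pv; apply/set_mem/PD. Qed.

Lemma idealM (A : comNzRingType) (P : set A) (a u : A) :
  idealr_closed (mem P) -> P u -> P (a * u).
Proof.
by move=> iP Pu; rewrite -[_ * _]addr0; apply: idealDM => //; exact: ideal0.
Qed.

Lemma idealD (A : comNzRingType) (P : set A) (u v : A) :
  idealr_closed (mem P) -> P u -> P v -> P (u + v).
Proof. by move=> iP Pu Pv; rewrite -[u]mul1r; exact: idealDM. Qed.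

Lemma idealB (A : comNzRingType) (P : set A) (u v : A) :
  idealr_closed (mem P) -> P u -> P v -> P (u - v).
Proof. by move=> iP Pu Pv; rewrite addrC -mulN1r; exact: idealDM. Qed.

Lemma ideal_cancel (A : comNzRingType) (P : set A) (u v : A) :
  idealr_closed (mem P) -> P (u - v) -> P v <-> P u.
Proof.
move=> iP Puv; split=> [Pv | Pu]; first by rewrite -(subrK v u); exact: idealD.
by rewrite -[v](subKr u); exact: idealB.
Qed.

Lemma ideal_bigsum (A : comNzRingType) (P : set A) (I : Type) (s : seq I)
    (a : pred I) (F : I -> A) :
  idealr_closed (mem P) -> (forall i, a i -> P (F i)) ->
  P (\sum_(i <- s | a i) F i).
Proof.
by move=> iP PF; elim/big_ind: _ => [|u v|//]; [exact: ideal0|exact: idealD].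
Qed.

Lemma primeM (A : comNzRingType) (P : set A) (u v : A) :
  prime_idealr_closed (mem P) -> P (u * v) -> P u \/ P v.
Proof. by move=> pP /mem_set/pP/orP[] /set_mem; [left|right]. Qed.

Lemma prime_intro (A : comNzRingType) (P : set A) :
  (forall u v, P (u * v) -> P u \/ P v) -> prime_idealr_closed (mem P).
Proof.
by move=> pP u v /set_mem/pP[] /mem_set Px; apply/orP; [left|right].
Qed.

Lemma prime_exp (A : comNzRingType) (P : set A) (x : A) c :
  idealr_closed (mem P) -> prime_idealr_closed (mem P) ->
  ~ P x -> ~ P (x ^+ c).
Proof.
move=> iP pP Px; elim: c => [|c IH]; first exact: ideal1.
by rewrite exprS => /(primeM pP)[].
Qed.

Lemma ideal_preimage (A B : comNzRingType) (phi : {rmorphism A -> B})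
    (P : set B) :
  idealr_closed (mem P) -> idealr_closed (mem (phi @^-1` P)).
Proof.
move=> iP; apply: ideal_intro => [||a u v Pu Pv] /=.
- by rewrite rmorph0; exact: ideal0.
- by rewrite rmorph1; exact: ideal1.
- by rewrite rmorphD rmorphM; exact: idealDM.
Qed.

Lemma prime_preimage (A B : comNzRingType) (phi : {rmorphism A -> B})
    (P : set B) :
  prime_idealr_closed (mem P) -> prime_idealr_closed (mem (phi @^-1` P)).
Proof.
by move=> pP; apply: prime_intro => u v /=; rewrite rmorphM; exact: primeM.
Qed.

(** * Chains of primes in a polynomial ring *)

Definition indep_mod (k : fieldType) (A : comAlgType k) (I : finType)
    (Q : set A) (F : I -> A) : Prop :=
  forall c : I -> k, Q (\sum_i c i *: F i) -> forall i, c i = 0.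

(** One step of the chain multiplies an independent family by the powers of an
    [f] in [Q] outside [Q']: in a relation modulo [Q'], the part free of [f]
    vanishes modulo [Q], hence is trivial by independence there; the rest is
    divisible by [f], which can be cancelled because [Q'] is prime. *)
Lemma indep_mod_powers (k : fieldType) (A : comAlgType k) (I : finType)
    (Q Q' : set A) (F : I -> A) (f : A) (D : nat) :
  idealr_closed (mem Q) -> prime_idealr_closed (mem Q') ->
  Q' `<=` Q -> Q f -> ~ Q' f ->
  indep_mod Q F ->
  indep_mod Q' (fun p : I * 'I_D => F p.1 * f ^+ p.2).
Proof.
move=> iQ pQ' sub Qf Q'f indF c.
have key : forall E (h : nat -> I -> k),
    Q' (\sum_(j < E) (\sum_i h j i *: F i) * f ^+ j) ->
    forall (j : 'I_E) i, h j i = 0.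
  elim=> [h _ []//|E IH h].
  rewrite big_ord_recl expr0 mulr1.
  under [X in _ + X]eq_bigr do rewrite lift0 exprS mulrCA.
  rewrite -mulr_sumr => Q'h.
  have h0 : forall i, h 0 i = 0.
    apply: indF; apply/(ideal_cancel iQ (u := \sum_i h 0 i *: F i + f *
      (\sum_(j < E) (\sum_i h j.+1 i *: F i) * f ^+ j)) _).
      by rewrite addrAC subrr add0r mulrC; exact: idealM.
    exact: sub.
  move: Q'h; rewrite big1 ?add0r => [Q'h|i _]; last by rewrite h0 scale0r.
  have {}Q'h := or_ind (fun b => False_ind _ (Q'f b)) id (primeM pQ' Q'h).
  move=> j i; case: (unliftP ord0 j) => [j' ->|->]; last exact: h0.
  exact: (IH (fun j => h j.+1)).
move=> Q'c [i j].
(* The induction on the number of powers needs coefficients indexed by [nat];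
   the default value 0 is never reached. *)
pose h (j : nat) i := if insub j is Some j' then c (i, j') else 0.
have hE (j' : 'I_D) i' : h j' i' = c (i', j').
  by rewrite /h insubT //= => ?; congr (c (_, _)); exact: val_inj.
rewrite -hE; apply: (key D h).
suff <- : \sum_p c p *: (F p.1 * f ^+ p.2) =
  \sum_(j < D) (\sum_i h j i *: F i) * f ^+ j by [].
under [RHS]eq_bigr do rewrite mulr_suml.
rewrite exchange_big pair_bigA /=.
by apply: eq_bigr => -[i' j'] _ /=; rewrite hE -scalerAl.
Qed.

Lemma msize_mul_leS (k : fieldType) s (p q : {mpoly k[s]}) a b :
  (msize p <= a.+1 -> msize q <= b.+1 -> msize (p * q) <= (a + b).+1)%N.
Proof.
have [->|p0] := eqVneq p 0; first by rewrite mul0r msize0.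
have [->|q0] := eqVneq q 0; first by rewrite mulr0 msize0.
rewrite msizeM //.
by move: (msize p) (msize q) => x y; lia.
Qed.

Lemma msize_exp_leS (k : fieldType) s (p : {mpoly k[s]}) a b :
  (msize p <= a.+1 -> msize (p ^+ b) <= (b * a).+1)%N.
Proof.
move=> pa; elim: b => [|b IH]; first by rewrite expr0 msize1.
by rewrite exprS mulSn; exact: msize_mul_leS.
Qed.

(** A crude bound is enough, since only the order of growth in [M] matters: each
    of the [s] exponents is below [M]. *)
Lemma card_bmnom_le s M : (#|{: 'X_{1..s < M}}| <= M ^ s)%N.
Proof.
case: M => [|M].
  by rewrite eq_card0 // => -[].
pose g (m : 'X_{1..s < M.+1}) : {ffun 'I_s -> 'I_M.+1} :=
  [ffun i => inord (bmnm m i)].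
have le (m : 'X_{1..s < M.+1}) i : (bmnm m i <= M)%N.
  rewrite -ltnS; apply: leq_ltn_trans (bmdeg m).
  by rewrite mdegE (bigD1 i) //= leq_addr.
have g_inj : injective g.
  move=> m1 m2 /ffunP E; apply/val_inj/mnmP => i.
  by have := E i; rewrite !ffunE => /(congr1 val); rewrite /= !inordK ?ltnS.
by rewrite (leq_trans (leq_card g g_inj)) // card_ffun !card_ord.
Qed.

(** Independence modulo a set containing 0 implies linear independence, so the family is
    no larger than the set of monomials available to it: its matrix of
    coefficients has independent rows. *)
Lemma indep_card_le (k : fieldType) s (I : finType) (F : I -> {mpoly k[s]})
    (Q : set {mpoly k[s]}) (M : nat) :
  Q 0 -> indep_mod Q F -> (forall i, msize (F i) <= M)%N -> (#|I| <= M ^ s)%N.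
Proof.
move=> Q0 indF Fs.
pose A := \matrix_(i < #|I|, j < #|{: 'X_{1..s < M}}|)
  (F (enum_val i))@_(bmnm (enum_val j)).
have fA : row_free A.
  apply: inj_row_free => v vA; apply/rowP => i; rewrite mxE.
  rewrite -[i]enum_valK; apply: (indF (fun i => v 0 (enum_rank i))).
  suff -> : \sum_i v 0 (enum_rank i) *: F i = 0 by [].
  apply/mpolyP => m; rewrite mcoeff0 raddf_sum /=.
  have [mM|mM] := ltnP (mdeg m) M; last first.
    apply: big1 => j _; rewrite mcoeffZ (@memN_msupp_eq0 _ _ (F j)) ?mulr0 //.
    by apply: msize_mdeg_ge; exact: leq_trans mM.
  have /rowP/(_ (enum_rank (BMultinom mM))) := vA.
  rewrite !mxE => vA0; rewrite -[RHS]vA0 (reindex (@enum_val I predT)) /=; last first.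
    by apply: onW_bij; exact: enum_val_bij.
  by apply: eq_bigr => j _; rewrite mcoeffZ mxE enum_valK enum_rankK.
rewrite (leq_trans _ (card_bmnom_le s M)) //.
by move/eqP: fA => <-; exact: rank_leq_col.
Qed.

(** The family consists of the products of the [f i] with all exponents below
    [D]; the point of the last clause is that its degrees grow only linearly
    with [D]. *)
Lemma indep_of_chain (k : fieldType) s (Q : nat -> set {mpoly k[s]}) L
    (f : nat -> {mpoly k[s]}) (D E : nat) :
  (forall i, (i <= L)%N -> idealr_closed (mem (Q i))) ->
  (forall i, (i < L)%N -> [/\ prime_idealr_closed (mem (Q i.+1)),
      Q i.+1 `<=` Q i, Q i (f i), ~ Q i.+1 (f i) & (msize (f i) <= E.+1)%N]) ->
  exists (I : finType) (F : I -> {mpoly k[s]}),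
   [/\ #|I| = (D ^ L)%N, indep_mod (Q L) F &
     forall i, (msize (F i) <= (L * (D * E)).+1)%N].
Proof.
elim: L => [|L IH] iQ Qf.
  exists unit, (fun=> 1); split=> [|c|_]; last by rewrite msize1.
  - by rewrite card_unit.
  move=> Qc []; have := Qc; rewrite (big_pred1 tt) /=; last by case.
  have [//|c0] := eqVneq (c tt) 0 => Q1.
  case: (ideal1 (iQ 0 isT)).
  rewrite (_ : 1 = (c tt)^-1%:MP * (c tt *: 1)); first exact: idealM (iQ 0 _) _.
  by rewrite mul_mpolyC scalerA mulVf // scale1r.
have [||I [F [cI iF sF]]] := IH; [by move=> i iL; apply/iQ/leqW|
  by move=> i iL; apply/Qf/leqW|].
have [pQ sQ Qf0 Qf1 fE] := Qf L (leqnn _).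
exists (I * 'I_D)%type, (fun p : I * 'I_D => F p.1 * f L ^+ p.2); split.
- by rewrite card_prod cI card_ord expnSr.
- by apply: (indep_mod_powers _ _ sQ) => //; exact/iQ/leqnSn.
move=> [i j] /=; rewrite mulSn addnC; apply: msize_mul_leS => //.
apply: leq_trans (msize_exp_leS j fE) _.
by rewrite ltnS leq_mul2r ltnW ?orbT.
Qed.

(** Only the first [s + 1] steps of a chain that is too long are used: they
    would give [D ^ (s + 1)] independent polynomials spanned by at most
    [(D * K) ^ s] monomials, with [K] depending on the degrees of the chosen
    elements alone; this fails as soon as [D > K ^ s]. *)
Theorem polynomial_chain_le (k : fieldType) s (Q : nat -> set {mpoly k[s]}) L :
  (forall i, (i <= L)%N -> idealr_closed (mem (Q i))) ->
  (forall i, (i < L)%N -> prime_idealr_closed (mem (Q i.+1))) ->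
  (forall i, (i < L)%N -> Q i.+1 `<` Q i) ->
  (L <= s)%N.
Proof.
move=> iQ pQ sQ; rewrite leqNgt; apply/negP => sL.
have fP i : {f : {mpoly k[s]} | (i < L)%N -> Q i f /\ ~ Q i.+1 f}.
  apply: cid; case: (ltnP i L) => [iL|]; last by exists 0.
  by have [_ /existsNP[f /not_implyP[]]] := sQ i iL; exists f.
pose f i := sval (fP i); pose E := \max_(i < L) msize (f i).
pose K := (s.+1 * E).+1.
have [i lti||I [F [cI iF sF]]] := @indep_of_chain k s Q s.+1 f (K ^ s).+1 E.
- by apply: iQ; exact: leq_trans lti sL.
- move=> i lti; have iL := leq_trans lti sL; have [Qf Q1f] := svalP (fP i) iL.
  split=> //; [exact: pQ|exact: properW (sQ i iL)|].
  by apply/leqW/(leq_bigmax (Ordinal iL)).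
have := indep_card_le (ideal0 (iQ _ sL)) iF sF.
rewrite cI leqNgt => /negP; apply.
apply: (@leq_ltn_trans (((K ^ s).+1 * K) ^ s)%N).
  have leX x y e : (x <= y -> x ^ e <= y ^ e)%N.
    by case: e => // e; rewrite leq_exp2r.
  apply: leX; rewrite /K mulnS mulnCA addSn ltnS.
  by rewrite leq_addl.
by rewrite expnMn expnSr ltn_pmul2l ?ltnS ?leqnn // expn_gt0.
Qed.

(** * The 2-minors of the two concatenations *)

Lemma ideal_generated_gen (A : comNzRingType) (G : set A) (a x : A) :
  G x -> ideal_generated G (a * x).
Proof.
move=> Gx; exists [:: (a, x)]; split; last by rewrite big_seq1.
by move=> y; rewrite inE => /eqP ->.
Qed.

Lemma ideal_generated0 (A : comNzRingType) (G : set A) : ideal_generated G 0.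
Proof. by exists [::]; rewrite big_nil. Qed.

Lemma ideal_generated_sub (A : comNzRingType) (G P : set A) :
  idealr_closed (mem P) -> G `<=` P -> ideal_generated G `<=` P.
Proof.
move=> iP GP _ [s [Gs ->]]; rewrite big_seq; apply: ideal_bigsum => // x /Gs Gx.
by apply: idealM => //; exact: GP.
Qed.

Lemma det_mx2 (A : comNzRingType) (M : 'M[A]_2) :
  \det M = M 0 0 * M 1 1 - M 0 1 * M 1 0.
Proof.
rewrite (expand_det_row _ ord0) !big_ord_recl big_ord0 /cofactor !det_mx11 !mxE.
rewrite /= expr0 mul1r expr1 mulN1r mulrN addr0.
by congr (M _ _ * M _ _ - M _ _ * M _ _); exact: val_inj.
Qed.

(** Minors are taken on increasing rows and columns only; for arbitrary indices
    the expression is 0 or one of these minors up to sign. *)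
Lemma minor2_mem (A : comNzRingType) p q (M : 'M[A]_(p, q)) i i' j j' :
  minor_ideal 2 M (M i j * M i' j' - M i j' * M i' j).
Proof.
pose pr (T : Type) (x y : T) (a : 'I_2) := if a == 0 then x else y.
have pr_homo t (x y : 'I_t) :
    (x < y)%N -> {homo pr _ x y : a b / (a < b)%N >-> (a < b)%N}.
  by move=> xy [[|[|?]] ?] [[|[|?]] ?].
have base (i1 i2 : 'I_p) (j1 j2 : 'I_q) : (i1 < i2)%N -> (j1 < j2)%N ->
    minors 2 M (M i1 j1 * M i2 j2 - M i1 j2 * M i2 j1).
  move=> li lj; exists (pr _ i1 i2), (pr _ j1 j2).
  by split; [exact: pr_homo|exact: pr_homo|rewrite det_mx2 !mxE].
have scaled (i1 i2 : 'I_p) (j1 j2 : 'I_q) a y : (i1 < i2)%N -> (j1 < j2)%N ->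
    y = a * (M i1 j1 * M i2 j2 - M i1 j2 * M i2 j1) -> minor_ideal 2 M y.
  by move=> li lj ->; exact/ideal_generated_gen/base.
have z0 x : x = 0 -> minor_ideal 2 M x by move=> ->; exact: ideal_generated0.
have [ii|ii|/val_inj ->] := ltngtP i i'; last by apply: z0; rewrite mulrC subrr.
- have [jj|jj|/val_inj ->] := ltngtP j j'; last by apply: z0; rewrite subrr.
  + by apply: (scaled _ _ _ _ 1 _ ii jj); ring.
  + by apply: (scaled _ _ _ _ (-1) _ ii jj); ring.
- have [jj|jj|/val_inj ->] := ltngtP j j'; last by apply: z0; rewrite subrr.
  + by apply: (scaled _ _ _ _ (-1) _ ii jj); ring.
  + by apply: (scaled _ _ _ _ 1 _ ii jj); ring.
Qed.

Section Toric.
Variables (k : fieldType) (r m n : nat).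
Local Notation x l i j := ('X_(enum_rank (l, i, j)) : {mpoly k[nvars r m n]}).

Lemma H_mxE l i j : H_mx k r m n i (tagnat.Rank l j) = x l i j.
Proof.
have /matrixP/(_ i j) := mxrowK (@X_mx k r m n) l.
by rewrite !mxE.
Qed.

Lemma V_mxE l i j : V_mx k r m n (tagnat.Rank l i) j = x l i j.
Proof.
have /matrixP/(_ i j) := mxcolK (@X_mx k r m n) l.
by rewrite !mxE.
Qed.

Lemma toric_H l l' i i' j j' :
  toric_ddv_ideal k r m n (x l i j * x l' i' j' - x l' i j' * x l i' j).
Proof.
rewrite -!H_mxE; apply: ex_intro2 (minor2_mem _ _ _ _ _) _.
by exists 0; [exact: ideal_generated0|rewrite addr0].
Qed.

Lemma toric_V l l' i i' j j' :
  toric_ddv_ideal k r m n (x l i j * x l' i' j' - x l i j' * x l' i' j).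
Proof.
rewrite -!V_mxE; exists 0; first exact: ideal_generated0.
by apply: ex_intro2 (minor2_mem _ _ _ _ _) _; rewrite add0r.
Qed.

(** A minor of [V] exchanges the columns [j] and [j0] between [x l i j] and the
    centre [x l0 i0 j0]; a minor of [H] then exchanges the rows [i] and [i0]
    between the factor [x l i j0] and a second copy of the centre. *)
Lemma toric_star (P : set {mpoly k[nvars r m n]}) l l0 i i0 j j0 :
  idealr_closed (mem P) -> toric_ddv_ideal k r m n `<=` P ->
  P (x l0 i0 j0 ^+ 2 * x l i j - x l i0 j0 * x l0 i j0 * x l0 i0 j).
Proof.
move=> iP sP.
have /sP/(idealM (x l0 i0 j0) iP) E1 := toric_V l l0 i i0 j j0.
have /sP/(idealM (x l0 i0 j) iP) E2 := toric_H l l0 i i0 j0 j0.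
suff -> : x l0 i0 j0 ^+ 2 * x l i j - x l i0 j0 * x l0 i j0 * x l0 i0 j =
  x l0 i0 j0 * (x l i j * x l0 i0 j0 - x l i j0 * x l0 i0 j) +
  x l0 i0 j * (x l i j0 * x l0 i0 j0 - x l0 i j0 * x l i0 j0).
  exact: idealD.
ring.
Qed.

End Toric.

(** The polynomials that fall into the image of [psi] modulo [P] after
    multiplication by a power of [psi t] form a subalgebra, so it suffices to
    check the variables. *)
Lemma localized_mpoly (k : fieldType) N s (P : set {mpoly k[N]})
    (psi : {rmorphism {mpoly k[s]} -> {mpoly k[N]}}) (t : {mpoly k[s]}) :
  idealr_closed (mem P) -> (forall c, psi c%:MP = c%:MP) ->
  (forall v, exists c q, P (psi t ^+ c * 'X_v - psi q)) ->
  forall f, exists c q, P (psi t ^+ c * f - psi q).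
Proof.
move=> iP psiC psiX.
pose S (f : {mpoly k[N]}) := exists c q, P (psi t ^+ c * f - psi q).
have SC c : S c%:MP.
  by exists 0%N, c%:MP; rewrite psiC mul1r subrr; exact: ideal0.
have SM f g : S f -> S g -> S (f * g).
  move=> [c [q Pf]] [d [p Pg]]; exists (c + d)%N, (q * p).
  rewrite rmorphM exprD.
  rewrite [X in P X](_ : _ = psi t ^+ d * g * (psi t ^+ c * f - psi q) +
    psi q * (psi t ^+ d * g - psi p)); last by ring.
  by apply: idealD => //; exact: idealM.
have SD f g : S f -> S g -> S (f + g).
  move=> [c [q Pf]] [d [p Pg]]; exists (c + d)%N, (t ^+ d * q + t ^+ c * p).
  rewrite rmorphD !rmorphM !rmorphXn exprD.
  rewrite [X in P X](_ : _ = psi t ^+ d * (psi t ^+ c * f - psi q) +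
    psi t ^+ c * (psi t ^+ d * g - psi p)); last by ring.
  by apply: idealD => //; exact: idealM.
have SX m : S 'X_[m].
  rewrite mpolyXE_id; apply: (big_ind S) => // [|i _]; first exact: (SC 1).
  by elim: (m i) => [|e IH]; [exact: (SC 1)|rewrite exprS; exact: SM].
elim/mpolyind => [|c m p _ _ Sp]; first by rewrite -mpolyC0; exact: SC.
by apply: SD => //; rewrite -mul_mpolyC; exact: SM.
Qed.

(** * From irreducible closed sets to primes *)

Definition vanishing_ideal (k : fieldType) N (Z : set (set {mpoly k[N]})) :
  set {mpoly k[N]} := [set p | forall Q, Z Q -> Q p].

Lemma homogeneous_mem (k : fieldType) N (Q : set {mpoly k[N]}) p :
  idealr_closed (mem Q) -> homogeneous_ideal Q ->
  Q p <-> forall d, Q (pihomog mdeg d p).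
Proof.
move=> iQ hQ; split=> [Qp d|Qp]; first exact: hQ.
by rewrite (@pihomog_partitionE _ _ mdeg _ p (leqnn _)); exact: ideal_bigsum.
Qed.

Lemma irrelevant_is_ideal (k : fieldType) N :
  idealr_closed (mem (@irrelevant_ideal k N)).
Proof.
apply: ideal_intro; rewrite /irrelevant_ideal /= ?rmorph0 ?rmorph1 //.
- by move/eqP; rewrite oner_eq0.
- by move=> a u v u0 v0; rewrite rmorphD rmorphM /= u0 v0 mulr0 addr0.
Qed.

(** A monomial other than 1 is divisible by some variable. *)
Lemma irrelevant_sub (k : fieldType) N (P : set {mpoly k[N]}) :
  idealr_closed (mem P) -> (forall v, P 'X_v) -> @irrelevant_ideal k N `<=` P.
Proof.
move=> iP PX p p0; rewrite [p]mpolyE big_seq; apply: ideal_bigsum => // m mp.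
rewrite -mul_mpolyC; apply: idealM => //.
have [i mi] : exists i, m i != 0%N.
  apply/existsP; apply: contraPT mp => /existsPn m0.
  have -> : m = 0%MM.
    by apply/mnmP => i; rewrite mnm0E; apply/eqP; rewrite -[_ == _]negbK m0.
  by rewrite mcoeff_msupp p0 eqxx.
rewrite mpolyXE_id (bigD1 i) //= mulrC; apply: idealM => //.
by rewrite -(prednK (n := m i)) ?lt0n // exprSr; exact: idealM.
Qed.

(** The component of degree 0 of a member is again a member, and a constant one,
    hence zero in a proper ideal. *)
Lemma sub_irrelevant (k : fieldType) N (P : set {mpoly k[N]}) :
  idealr_closed (mem P) -> homogeneous_ideal P -> P `<=` @irrelevant_ideal k N.
Proof.
move=> iP hP p /(hP 0%N) Pp; apply: contra_notP (ideal1 iP) => /eqP p0.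
suff E : pihomog mdeg 0 p = p@_0%MM *: 1.
  rewrite (_ : 1 = (p@_0%MM)^-1%:MP * pihomog mdeg 0 p); first exact: idealM.
  by rewrite E mul_mpolyC scalerA mulVf // scale1r.
rewrite {1}[p]mpolyE raddf_sum /= (bigD1_seq 0%MM) ?msupp_uniq //=; last first.
  by rewrite mcoeff_msupp.
rewrite linearZ /= pihomogX /= mdeg0 eqxx mpolyX0 big1 ?addr0 // => m m0.
by rewrite linearZ /= pihomogX /= mdeg_eq0 (negPf m0) scaler0.
Qed.

(** If [u * v] vanishes on [Z], then [Z] is the union of the loci in [Z] of [u]
    and of [v], and irreducibility makes one of them all of [Z].  These loci are
    closed although [u] and [v] need not be homogeneous, because a homogeneous
    ideal contains [u] exactly when it contains all its components. *)
Lemma vanishing_ideal_prime (k : fieldType) N (X Z : set (set {mpoly k[N]})) :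
  X `<=` @Proj k N -> irreducible_closed (zariski_closed X) Z ->
  idealr_closed (mem (vanishing_ideal Z)) /\
  prime_idealr_closed (mem (vanishing_ideal Z)).
Proof.
move=> XProj [[G Ghom GZ] [Q0 ZQ0] Zirr].
have ZX : Z `<=` X by rewrite -GZ => Q [].
have ZP Q : Z Q -> @Proj k N Q by move/ZX/XProj.
split; first apply: ideal_intro.
- by move=> Q /ZP[/ideal0].
- by move/(_ _ ZQ0); have [/ideal1] := ZP _ ZQ0.
- move=> a u v Zu Zv Q ZQ; have [iQ _ _ _] := ZP _ ZQ.
  by apply: idealDM; [|exact: Zu|exact: Zv].
apply: prime_intro => u v Zuv.
pose locus p := Z `&` [set Q | Q p].
have closed_locus p : zariski_closed X (locus p).
  exists (G `|` [set pihomog mdeg d p | d in setT]).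
    move=> q [/Ghom//|[d _ <-]]; exists d; exact: pihomogP.
  rewrite /locus -GZ; apply/seteqP; split=> Q.
    move=> [XQ [PQ GQ]]; have [iQ _ hQ _] := PQ.
    split; first by split=> //; split=> // q Gq; apply: GQ; left.
    apply/(homogeneous_mem _ iQ hQ) => d; apply: GQ; right; exists d => //.
  move=> [[XQ [PQ GQ]] Qp]; have [iQ _ hQ _] := PQ.
  split=> //; split=> // q [/GQ//|[d _ <-]]; exact: hQ.
have Zuv' : Z = locus u `|` locus v.
  apply/seteqP; split=> Q; last by case=> -[].
  move=> ZQ; have [_ pQ _ _] := ZP _ ZQ.
  by have [Qu|Qv] := primeM pQ (Zuv _ ZQ); [left|right].
by have [E|E] := Zirr _ _ (closed_locus u) (closed_locus v) Zuv';
  [left|right] => Q; rewrite E => -[].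
Qed.

Lemma vanishing_ideal_homogeneous (k : fieldType) N
    (Z : set (set {mpoly k[N]})) :
  Z `<=` @Proj k N -> homogeneous_ideal (vanishing_ideal Z).
Proof. by move=> ZP d p Zp Q ZQ; have [_ _ + _] := ZP _ ZQ; apply; exact: Zp. Qed.

(** Inclusion-reversal is strict because a closed set is recovered from its
    vanishing ideal: the equations that define it belong to that ideal. *)
Lemma vanishing_ideal_proper (k : fieldType) N (X Y Z : set (set {mpoly k[N]})) :
  zariski_closed X Y -> zariski_closed X Z -> Y `<` Z ->
  vanishing_ideal Z `<` vanishing_ideal Y.
Proof.
move=> [G _ <-] [F _ FZ] [sub nsub]; split=> [p Zp Q /sub /Zp //|VYZ].
apply: nsub => Q ZQ; have := ZQ; rewrite -{1}FZ => -[XQ [PQ _]].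
split=> //; split=> // p Gp.
by apply: (VYZ p) => // Q' [_ [_]]; exact.
Qed.

(** * The upper bound: reduction to the star of a variable *)

Section Star.
Variables (k : fieldType) (r m n : nat) (l0 : 'I_r) (i0 : 'I_m) (j0 : 'I_n).

(** The centre [(l0, i0, j0)] is split off as [None]: it lies on all three lines
    of the star and must be counted once for the bound to be sharp. *)
Definition star_index : finType :=
  option ({l | l != l0} + {i | i != i0} + {j | j != j0}).

Definition star_var (w : star_index) : 'I_(nvars r m n) :=
  enum_rank match w with
  | None => (l0, i0, j0)
  | Some (inl (inl l)) => (val l, i0, j0)
  | Some (inl (inr i)) => (l0, val i, j0)
  | Some (inr j) => (l0, i0, val j)
  end.

Lemma card_star_index : (#|star_index| = (r.-1 + m.-1 + n.-1).+1)%N.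
Proof. by rewrite card_option !card_sum !card_sig !cardC1 !card_ord. Qed.

Definition star_map : {mpoly k[#|star_index|]} -> {mpoly k[nvars r m n]} :=
  comp_mpoly [tuple 'X_(star_var (enum_val w)) | w < #|star_index|].

HB.instance Definition _ := GRing.RMorphism.on star_map.

Lemma star_mapC c : star_map c%:MP = c%:MP.
Proof. exact: comp_mpolyC. Qed.

Lemma star_mapX w : star_map 'X_(enum_rank w) = 'X_(star_var w).
Proof. by rewrite /star_map comp_mpolyXU -tnth_nth tnth_mktuple enum_rankK. Qed.

Lemma star_map_localized (P : set {mpoly k[nvars r m n]}) f :
  idealr_closed (mem P) -> toric_ddv_ideal k r m n `<=` P ->
  exists c q, P ('X_(star_var None) ^+ c * f - star_map q).
Proof.
move=> iP sP; rewrite -star_mapX.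
apply: (localized_mpoly (psi := star_map)) => //; first exact: star_mapC.
move=> v; exists 2%N.
have lE l : exists w, star_var w = enum_rank (l, i0, j0).
  by have [->|ne] := eqVneq l l0; [exists None|exists (Some (inl (inl (exist _ l ne))))].
have iE i : exists w, star_var w = enum_rank (l0, i, j0).
  by have [->|ne] := eqVneq i i0; [exists None|exists (Some (inl (inr (exist _ i ne))))].
have jE j : exists w, star_var w = enum_rank (l0, i0, j).
  by have [->|ne] := eqVneq j j0; [exists None|exists (Some (inr (exist _ j ne)))].
rewrite -[v]enum_valK; case: (enum_val v) => [[l i] j].
have [wl El] := lE l; have [wi Ei] := iE i; have [wj Ej] := jE j.
exists ('X_(enum_rank wl) * 'X_(enum_rank wi) * 'X_(enum_rank wj)).
rewrite !rmorphM /= !star_mapX El Ei Ej.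
exact: toric_star.
Qed.

End Star.

(** The contracted chain has one step more than the chain of closed sets, its
    first ideal being the contraction of the irrelevant ideal; the centre of the
    star witnesses that this extra step is strict. *)
Lemma toric_chain_le (k : fieldType) (r m n e : nat) :
  irreducible_chain (zariski_closed (toric_ddv k r m n)) e ->
  (e <= r.-1 + m.-1 + n.-1)%N.
Proof.
move=> [Z [Zirr Zlt]]; pose P i := vanishing_ideal (Z i).
have XProj : toric_ddv k r m n `<=` @Proj _ _ by move=> Q [].
have ZX i : (i <= e)%N -> Z i `<=` toric_ddv k r m n.
  by move=> ie; have [[G _ <-] _ _] := Zirr _ ie => Q [].
have PP i ie := vanishing_ideal_prime XProj (Zirr i ie).
have PI i : (i <= e)%N -> toric_ddv_ideal k r m n `<=` P i.
  by move=> ie p Ip Q /(ZX i ie)[_]; exact.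
have Plt i : (i < e)%N -> P i.+1 `<` P i.
  move=> ie; have [C1 _ _] := Zirr _ ie; have [C0 _ _] := Zirr _ (ltnW ie).
  exact: vanishing_ideal_proper C0 C1 (Zlt _ ie).
have P0 i : (i <= e)%N -> P i `<=` P 0%N.
  by elim: i => [_ p //|i IH ie p] /(properW (Plt _ ie))/(IH (ltnW ie)).
(* Otherwise a point of the smallest closed set contains every variable and so
   the irrelevant ideal. *)
have [v Pv] : exists v, ~ P 0%N 'X_v.
  apply/existsNP => PX; have [_ [Q ZQ] _] := Zirr 0%N (leq0n e).
  have [iQ _ _] := XProj _ (ZX _ (leq0n e) _ ZQ); apply.
  by apply: irrelevant_sub => // w; exact: PX.
move: Pv; rewrite -[v]enum_valK; case: (enum_val v) => [[l0 i0] j0] Px0.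
pose psi := @star_map k r m n l0 i0 j0.
pose Q i := if i is i'.+1 then psi @^-1` (P i')
  else psi @^-1` (@irrelevant_ideal k _).
rewrite -ltnS -(card_star_index l0 i0 j0).
apply: (@polynomial_chain_le k _ Q).
- move=> [_|i ie]; apply: ideal_preimage; first exact: irrelevant_is_ideal.
  by have [] := PP i ie.
- by move=> i ie; apply: prime_preimage; have [] := PP i ie.
move=> [_|i]; last rewrite ltnS => ie; split.
- move=> p /=; apply: (@sub_irrelevant _ _ (P 0%N)); first by have [] := PP 0%N (leq0n e).
  apply: vanishing_ideal_homogeneous.
  by move=> J /(ZX 0%N (leq0n e))/XProj.
- move/(_ 'X_(enum_rank None)); rewrite /Q /= /psi star_mapX; apply: contra_not Px0.
  by apply; rewrite /irrelevant_ideal /= mcoeffX mnm1_eq0.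
- by move=> p /=; exact: properW (Plt _ ie) _.
move=> sub; have [iP pP] := PP _ ie; have [iP' _] := PP _ (ltnW ie).
have [Psub] := Plt _ ie; apply=> f Pf.
(* The witness [f] is replaced by [psi q], which comes from the star variables
   and is congruent to a multiple of [f] modulo the smaller prime. *)
have [c [q Pq]] := star_map_localized l0 i0 j0 f iP (PI _ ie).
have Pq' : P i.+1 (psi q).
  apply: sub; exact: ((ideal_cancel iP' (Psub _ Pq)).2 (idealM _ iP' Pf)).
have /(primeM pP)[|//] := (ideal_cancel iP Pq).1 Pq'.
move=> Pxc; exfalso; apply: prime_exp Pxc => // /(P0 _ ie).
exact: Px0.
Qed.

(** * The lower bound: products of linear subspaces *)

Definition prime_locus (k : fieldType) N (X : set (set {mpoly k[N]}))
    (P : set {mpoly k[N]}) : set (set {mpoly k[N]}) :=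
  X `&` proj_zeros [set p | P p /\ exists d, p \is d.-homog].

(** The prime [P] is a generic point of its locus: a closed set that contains
    it contains the whole locus. *)
Lemma prime_locus_irreducible (k : fieldType) N (X : set (set {mpoly k[N]}))
    (P : set {mpoly k[N]}) :
  X `<=` @Proj k N -> X P -> irreducible_closed (zariski_closed X) (prime_locus X P).
Proof.
move=> XProj XP.
have PZ : prime_locus X P P.
  by split=> //; split; [exact: XProj|move=> p []].
have sub G : (forall p, G p -> exists d, p \is d.-homog) ->
    (X `&` proj_zeros G) P -> prime_locus X P `<=` X `&` proj_zeros G.
  move=> Ghom [_ [_ GP]] Q [XQ [PQ QP]]; split=> //; split=> // p Gp.
  by apply: QP; split; [exact: GP|exact: Ghom].
split; [|by exists P|].
  by eexists; last reflexivity; move=> p [].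
move=> A B [G Ghom <-] [F Fhom <-] E.
have := PZ; rewrite {1}E => -[/(sub _ Ghom) PG|/(sub _ Fhom) PF]; [left|right].
  by apply/seteqP; split=> //; rewrite E => Q GQ; left.
by apply/seteqP; split=> //; rewrite E => Q FQ; right.
Qed.

Lemma mpoly_rmorph_ext (k : fieldType) N (S : comNzRingType)
    (f g : {rmorphism {mpoly k[N]} -> S}) :
  (forall c, f c%:MP = g c%:MP) -> (forall v, f 'X_v = g 'X_v) -> f =1 g.
Proof.
move=> fgC fgX p; rewrite [p]mpolyE !rmorph_sum; apply: eq_bigr => q _.
rewrite -mul_mpolyC !rmorphM fgC mpolyXE_id !rmorph_prod; congr (_ * _).
by apply: eq_bigr => v _; rewrite !rmorphXn fgX.
Qed.

Section Coordinate.
Variables (k : fieldType) (r m n : nat).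

Definition factor_index : finType := ('I_r + 'I_m + 'I_n)%type.

(** The weight is the stage from which a factor variable is nonzero.  The first
    variable of each group is nonzero throughout, and the weights of the others
    run through 1, ..., [r.-1 + m.-1 + n.-1] without repetition, so that each
    stage restores exactly one variable. *)
Definition factor_weight (u : factor_index) : nat :=
  match u with
  | inl (inl l) => l
  | inl (inr i) => if i == 0%N :> nat then 0 else r.-1 + i
  | inr j => if j == 0%N :> nat then 0 else r.-1 + m.-1 + j
  end.

Definition factor_var t (u : factor_index) : {mpoly k[#|factor_index|]} :=
  if (factor_weight u <= t)%N then 'X_(enum_rank u) else 0.

Definition segre t : {mpoly k[nvars r m n]} -> {mpoly k[#|factor_index|]} :=
  comp_mpoly [tuple let: (l, i, j) := enum_val v in
    factor_var t (inl (inl l)) * factor_var t (inl (inr i)) * factor_var t (inr j)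
    | v < nvars r m n].

HB.instance Definition _ t := GRing.RMorphism.on (segre t).

Lemma segreX t l i j :
  segre t 'X_(enum_rank (l, i, j)) =
  factor_var t (inl (inl l)) * factor_var t (inl (inr i)) * factor_var t (inr j).
Proof. by rewrite /segre comp_mpolyXU -tnth_nth tnth_mktuple enum_rankK. Qed.

Lemma segreC t c : segre t c%:MP = c%:MP.
Proof. exact: comp_mpolyC. Qed.

Lemma segreX_eq0 t l i j :
  (segre t 'X_(enum_rank (l, i, j)) == 0) =
  [|| (t < factor_weight (inl (inl l)))%N, (t < factor_weight (inl (inr i)))%N
    | (t < factor_weight (inr j))%N].
Proof.
have var0 u : (factor_var t u == 0) = (t < factor_weight u)%N.
  rewrite /factor_var ltnNge; case: leqP => _; last by rewrite eqxx.
  by apply/negbTE; rewrite -msize_poly_eq0 msizeX.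
by rewrite segreX !mulf_eq0 !var0 orbA.
Qed.

Definition specialize t : {mpoly k[#|factor_index|]} -> {mpoly k[#|factor_index|]} :=
  comp_mpoly [tuple factor_var t (enum_val u) | u < #|factor_index|].

HB.instance Definition _ t := GRing.RMorphism.on (specialize t).

Lemma specialize_factor_var t u : specialize t (factor_var t.+1 u) = factor_var t u.
Proof.
rewrite /factor_var; have [le|lt] := leqP (factor_weight u) t.+1.
  by rewrite /specialize comp_mpolyXU -tnth_nth tnth_mktuple enum_rankK.
by rewrite rmorph0 ifN // -ltnNge ltnW.
Qed.

(** Each stage factors through the next one, so the kernels decrease. *)
Lemma specialize_segre t p : specialize t (segre t.+1 p) = segre t p.
Proof.
apply: (mpoly_rmorph_ext (f := specialize t \o segre t.+1)) => [c|v] /=.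
  by rewrite !segreC; exact: comp_mpolyC.
rewrite -[v]enum_valK; case: (enum_val v) => [[l i] j].
by rewrite !segreX !rmorphM /= !specialize_factor_var.
Qed.

Definition segre_kernel t : set {mpoly k[nvars r m n]} :=
  [set p | segre t p = 0].

(** The Segre map multiplies degrees by 3 and hence commutes with taking
    homogeneous components, which makes its kernel homogeneous. *)
Lemma segre_pihomog t d p :
  segre t (pihomog mdeg d p) = pihomog mdeg (3 * d) (segre t p).
Proof.
have var_homog u : factor_var t u \is 1.-homog.
  rewrite /factor_var; case: ifP => _; last exact: dhomog0.
  by rewrite dhomogX /= mdeg1.
have mon_homog mu : segre t 'X_[mu] \is (3 * mdeg mu).-homog.
  rewrite /segre comp_mpolyX mdegE big_distrr /=.
  pose hom d (q : {mpoly k[#|factor_index|]}) := q \is d.-homog.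
  apply: (big_ind2 hom) => [|d1 p1 d2 p2|v _]; [exact: dhomog1|exact: dhomogM|].
  apply: dhomogMn; rewrite tnth_mktuple; case: (enum_val v) => [[l i] j].
  exact: (dhomogM (dhomogM (var_homog _) (var_homog _)) (var_homog _)).
elim/mpolyind: p => [|c mu p _ _ IH]; first by rewrite !raddf0.
rewrite !raddfD /= IH; congr (_ + _).
rewrite linearZ /= pihomogX -[_ *: 'X_[mu]]mul_mpolyC rmorphM /= segreC mul_mpolyC.
rewrite linearZ /=; have [<-|ne] := eqVneq (mdeg mu) d.
  by rewrite (pihomog_dE (mon_homog mu)) -mul_mpolyC rmorphM /= segreC mul_mpolyC.
rewrite scaler0 rmorph0 (pihomog_ne0 _ (mon_homog mu)) ?scaler0 //.
by rewrite eqn_pmul2l.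
Qed.

Lemma segre_kernel_ideal t : idealr_closed (mem (segre_kernel t)).
Proof.
rewrite /segre_kernel; apply: ideal_intro => /= [||a u v u0 v0].
- by rewrite rmorph0.
- by rewrite rmorph1 => /eqP; rewrite oner_eq0.
- by rewrite rmorphD rmorphM /= u0 v0 mulr0 addr0.
Qed.

(** A product [a_l b_i c_j] is a product of a function of the row and a function
    of the column for [H], where [i] indexes the rows, as well as for [V], where
    [j] indexes the columns. *)
Lemma toric_sub_kernel t : toric_ddv_ideal k r m n `<=` segre_kernel t.
Proof.
have ker_ideal := segre_kernel_ideal t.
move=> _ [u Hu [v Vv <-]]; apply: idealD => //.
  apply: ideal_generated_sub Hu => // _ [f [g [_ _ ->]]].
  rewrite /segre_kernel /= det_mx2 !mxE rmorphB !rmorphM /= !segreX; ring.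
apply: ideal_generated_sub Vv => // _ [f [g [_ _ ->]]].
rewrite /segre_kernel /= det_mx2 !mxE rmorphB !rmorphM /= !segreX; ring.
Qed.

Lemma segre_kernel_mem t : (0 < r)%N -> (0 < m)%N -> (0 < n)%N ->
  toric_ddv k r m n (segre_kernel t).
Proof.
move=> r0 m0 n0; split; last exact: toric_sub_kernel.
split; first exact: segre_kernel_ideal.
- apply: prime_intro => u v /=; rewrite /segre_kernel /= rmorphM /=.
  by move/eqP; rewrite mulf_eq0 => /orP[] /eqP; [left|right].
- by move=> d p; rewrite /segre_kernel /= segre_pihomog => ->; rewrite raddf0.
move/(_ 'X_(enum_rank (Ordinal r0, Ordinal m0, Ordinal n0))).
rewrite /irrelevant_ideal /segre_kernel /= mcoeffX mnm1_eq0 => /(_ erefl)/eqP.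
by rewrite segreX_eq0.
Qed.

Lemma segre_kernel_sub t : segre_kernel t.+1 `<=` segre_kernel t.
Proof.
by move=> p; rewrite /segre_kernel /= -(specialize_segre t) => ->; rewrite rmorph0.
Qed.

(** The variable [x_(l,0,0)], [x_(0,i,0)] or [x_(0,0,j)] whose nonzero index has
    weight [t + 1] is the coordinate restored at stage [t + 1]. *)
Lemma segre_kernel_var t : (0 < r)%N -> (0 < m)%N -> (0 < n)%N ->
  (t < r.-1 + m.-1 + n.-1)%N ->
  exists v, segre_kernel t 'X_v /\ ~ segre_kernel t.+1 'X_v.
Proof.
move=> r0 m0 n0 tlt.
suff [[[l i] j]] : exists v : 'I_r * 'I_m * 'I_n, let: (l, i, j) := v in
   (segre t 'X_(enum_rank (l, i, j)) == 0) &&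
   (segre t.+1 'X_(enum_rank (l, i, j)) != 0).
  by move=> /andP[/eqP E /eqP E']; exists (enum_rank (l, i, j)).
have [tr|rt] := ltnP t.+1 r.
  exists (Ordinal tr, Ordinal m0, Ordinal n0).
  by rewrite !segreX_eq0 /= ltnSn ltnn.
have [tm|mt] := ltnP (t.+1 - r.-1) m.
  exists (Ordinal r0, Ordinal tm, Ordinal n0).
  have /negPf ne0 : (t.+1 - r.-1 != 0)%N by lia.
  by rewrite !segreX_eq0 /= ne0; lia.
have tn : (t.+1 - (r.-1 + m.-1) < n)%N by lia.
exists (Ordinal r0, Ordinal m0, Ordinal tn).
have /negPf ne0 : (t.+1 - (r.-1 + m.-1) != 0)%N by lia.
by rewrite !segreX_eq0 /= ne0; lia.
Qed.

Lemma toric_chain : (0 < r)%N -> (0 < m)%N -> (0 < n)%N ->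
  irreducible_chain (zariski_closed (toric_ddv k r m n))
    (r.-1 + m.-1 + n.-1).
Proof.
move=> r0 m0 n0; pose X := toric_ddv k r m n.
have KX t : X (segre_kernel t) by exact: segre_kernel_mem.
exists (fun t => prime_locus X (segre_kernel t)); split=> t tN.
  by apply: (prime_locus_irreducible _ (KX t)) => Q [].
split=> [Q [XQ [PQ QP]]|sub].
  split=> //; split=> // p [Kp hp]; apply: QP; split=> //.
  exact: segre_kernel_sub.
have [v [Kv Kv']] := segre_kernel_var r0 m0 n0 tN.
have [_ [_ K]] : prime_locus X (segre_kernel t) (segre_kernel t.+1).
  apply: sub; split=> //; split; last by move=> p [].
  by have [] := KX t.+1.
apply: Kv'; apply: K; split=> //; exists 1%N.
by rewrite dhomogX /= mdeg1.
Qed.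

End Coordinate.

(** * The dimension *)

Local Close Scope classical_set_scope.
Local Close Scope ring_scope.

Theorem corollary3p4 (k : fieldType) (r m n : nat)
  (hk : perfect_field k) (hr : 2 <= r) (hm : 2 <= m) (hn : 2 <= n) :
  projective_dim (toric_ddv k r m n) (m + n + r - 3).
Proof.
have -> : m + n + r - 3 = r.-1 + m.-1 + n.-1 by lia.
split; last exact: toric_chain_le.
by apply: toric_chain; lia.
Qed.
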